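(* Let $G$ be a group and $G+_{\partial}Y \in EPers(G)$ with action $L+\varphi: G \curvearrowright G+_{\partial}Y$. Let $P \subseteq Y$ be the set of bounded parabolic points of $L+\varphi$ lying in $Y$, $P' \subseteq P$ a set of representatives of orbits, and $\{Stab_{\varphi} p+_{\partial_{p}}C_{p}\}_{p\in P'}$ a family with $Stab_{\varphi} p+_{\partial_{p}}C_{p}\in EPers(Stab_\varphi p)$ and actions $L_p+\eta_{p}$; put $\mathcal C=\{C_p\}_{p\in P'}$, $\eta=\{\eta_p\}_{p\in P'}$, and let $(G+_{\partial}Y)\ltimes \mathcal{C}$ be the corresponding parabolic blowup with action $(L+\varphi)\ltimes\eta$. Then the map $\iota: G \rightarrow (G+_{\partial}Y)\ltimes \mathcal{C}$, induced by the inclusion maps $G \rightarrow G+_{\partial}Y$ and $G \rightarrow X_{p}$ ($p\in P$), is an embedding, its image is open, and $\iota$ is equivariant with respect to the left multiplication action $L$ and $(L+\varphi)\ltimes \eta$.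
   Context: Groups are discrete. An action of a group $H$ on a locally compact Hausdorff space $V$ is properly discontinuous if for every compact $K\subseteq V$ the set $\{h\in H: hK\cap K\neq\emptyset\}$ is finite, and cocompact if $HK=V$ for some compact $K\subseteq V$. A point $p$ of a compact Hausdorff space $Z$ on which $G$ acts by homeomorphisms is bounded parabolic if its stabilizer acts properly discontinuously and cocompactly on $Z\setminus\{p\}$. A compact Hausdorff space has a unique compatible uniform structure; for an entourage $u$, a subset $A$ is $u$-small if $A\times A\subseteq u$. Gluing notation: $V+_fC$ denotes a topological space with underlying set $V\sqcup C$ in which $V$ is open and $V$, $C$ carry their given topologies; $f$ records the topology via $f(A)=\overline{A}\cap C$ for $A$ closed in $V$ (so $B$ is closed iff $B\cap V$, $B\cap C$ are closed in $V$, $C$ and $f(B\cap V)\subseteq B$). $EPers(H)$, for a discrete group $H$: compact Hausdorff spaces $H+_\partial C$ with an action $L+\eta$ of $H$ by homeomorphisms ($L$ left multiplication on $H$, $\eta$ an action on $C$) such that for every entourage $u$ and every finite $F\subseteq H$, $hF$ is $u$-small for all but finitely many $h\in H$. Given $H+_\partial C\in EPers(H)$ and a properly discontinuous cocompact action of $H$ on a locally compact Hausdorff $V$ with compact $K\subseteq V$ such that $HK=V$, let $V+_{\partial_\Pi}C$ be the gluing given by $\partial_\Pi(S)=\partial(\{h\in H: hK\cap S\neq\emptyset\})$ for $S$ closed in $V$; it is compact Hausdorff and independent of $K$. Parabolic blowup of $Z=G+_\partial Y$ with action $\Phi=L+\varphi$, at the points of $P$: for $p\in P'$ and $q$ in its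 orbit choose $h_{p,q}\in G$ with $\Phi(h_{p,q},p)=q$, $h_{p,p}=1$; put $C_q=C_p$ and let $Stab_\varphi q+_{\partial_q}C_q$ have the topology making the map $x\mapsto h_{p,q}^{-1}xh_{p,q}$ on $Stab_\varphi q$ together with $\mathrm{id}$ on $C_q=C_p$ a homeomorphism onto $Stab_\varphi p+_{\partial_p}C_p$. Let $X_q=(Z\setminus\{q\})+_{(\partial_q)_\Pi}C_q$ and let $\pi_q:X_q\to Z$ be the identity on $Z\setminus\{q\}$ and send $C_q$ to $q$. Then $Z\ltimes\mathcal C=\{(z,(x_q)_{q\in P}): \pi_q(x_q)=z\ \forall q\}\subseteq Z\times\prod_{q\in P} X_q$. $G$ acts by $\Phi\ltimes\eta$, induced by $\Phi$ and the maps $X_q\to X_{\Phi(g,q)}$ equal to $\Phi(g,\cdot)$ on $Z\setminus\{q\}$ and to $\eta_p(h_{p,\Phi(g,q)}^{-1}gh_{p,q},\cdot)$ on $C_q$. *)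

(* Defs.v *)
From HB Require Import structures.
From mathcomp Require Import all_boot all_classical.
From mathcomp Require Import topology_structure uniform_structure compact.
From mathcomp Require Import separation_axioms discrete_topology.
From mathcomp Require Import initial_topology product_topology subspace_topology.
From mathcomp Require Import subtype_topology function_spaces.

Set Implicit Arguments.
Unset Strict Implicit.
Unset Printing Implicit Defensive.

Local Open Scope classical_set_scope.
Local Open Scope group_scope.

(** * Group actions *)

Record gaction (H : groupType) (X : Type) := Gaction {
  gact :> H -> X -> X;
  gact1 : forall x, gact 1 x = x;
  gactM : forall g h x, gact (g * h) x = gact g (gact h x)
}.

Section actions.
Context {H : groupType}.

Lemma gactK X (a : gaction H X) g : cancel (a g) (a g^-1).
Proof. by move=> x; rewrite -gactM mulVg gact1. Qed.

Lemma gactKV X (a : gaction H X) g : cancel (a g^-1) (a g).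
Proof. by move=> x; rewrite -gactM mulgV gact1. Qed.

Definition lmul_act : gaction H H :=
  @Gaction H H (fun g h => g * h) (@mul1g H) (fun g h x => esym (mulgA g h x)).

Definition sum_fun X Y (a : H -> X -> X) (b : H -> Y -> Y) (g : H)
    (z : X + Y) : X + Y :=
  match z with inl x => inl (a g x) | inr y => inr (b g y) end.

Lemma sum_fun1 X Y (a : gaction H X) (b : gaction H Y) z : sum_fun a b 1 z = z.
Proof. by case: z => z /=; rewrite gact1. Qed.

Lemma sum_funM X Y (a : gaction H X) (b : gaction H Y) g h z :
  sum_fun a b (g * h) z = sum_fun a b g (sum_fun a b h z).
Proof. by case: z => z /=; rewrite gactM. Qed.

Definition sum_act X Y (a : gaction H X) (b : gaction H Y) : gaction H (X + Y) :=
  Gaction (sum_fun1 a b) (sum_funM a b).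

Definition gorbit X (a : gaction H X) (x : X) : set X := range (a ^~ x).

Definition stab X (a : gaction H X) (x : X) : set H := [set h | a h x = x].

Definition Stab X (a : gaction H X) (x : X) : Type := set_type (stab a x).

End actions.

Section stabilizer.
Context {H : groupType} {X : Type} (a : gaction H X) (x : X).

Lemma stab_group_closed : group_closed (fun h => h \in stab a x).
Proof.
split; first by rewrite !inE /stab /= gact1.
move=> g h; rewrite !inE /stab /= => gx hx.
by rewrite gactM -{1}hx gactK.
Qed.

HB.instance Definition _ := SubChoice.copy (Stab a x) (set_type (stab a x)).
HB.instance Definition _ :=
  SubChoice_isSubGroup.Build H _ (Stab a x) stab_group_closed.

Lemma StabP (h : Stab a x) : a (val h) x = x.
Proof. by case: h => h /= /set_mem. Qed.

Definition mkStab h (hx : a h x = x) : Stab a x :=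
  exist _ h (mem_set (hx : stab a x h)).

End stabilizer.

(* Conjugation x |-> h^-1 x h from the stabilizer of y = h x to that of x. *)
Section conj_stab.
Context {H : groupType} {X : Type} (a : gaction H X) (h : H) (x y : X).
Hypothesis hxy : a h x = y.

Lemma conj_stab_subproof (g : Stab a y) : a (h^-1 * val g * h) x = x.
Proof. by rewrite !gactM hxy StabP -hxy gactK. Qed.

Definition conj_stab (g : Stab a y) : Stab a x := mkStab (conj_stab_subproof g).

Lemma conj_stab_bij : set_bij setT setT conj_stab.
Proof.
split=> //.
- move=> g k _ _ /(congr1 val) /= gk; apply: val_inj.
  by apply: (@mulgI _ h^-1); apply: (@mulIg _ h).
- move=> k _; have hk : a (h * val k * h^-1) y = y.
    by rewrite !gactM -{1}hxy gactK StabP hxy.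
  by exists (mkStab hk) => //; apply: val_inj; rewrite /= !mulgA mulVg mul1g mulgVK.
Qed.

End conj_stab.

(* X \ {x}, with the subspace topology, and the action of Stab x on it. *)
Definition punctured (X : topologicalType) (x : X) : topologicalType :=
  set_type (~` [set x]).

Section punctured.
Context {H : groupType} {X : topologicalType} (a : gaction H X).

Lemma puncturedP (x : X) (z : punctured x) : val z <> x.
Proof. by case: z => z /= /set_mem. Qed.

Definition mkPunctured (x z : X) (zx : z <> x) : punctured x :=
  exist _ z (mem_set (zx : (~` [set x]) z)).

Lemma val_inj_punctured (x : X) : injective (val : punctured x -> X).
Proof. exact: val_inj. Qed.

Lemma translate_subproof g (x y : X) (gxy : a g x = y) (z : punctured x) :
  a g (val z) <> y.
Proof.
rewrite -gxy => /(congr1 (a g^-1)); rewrite !gactK; exact: puncturedP.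
Qed.

(* The restriction of x' |-> g x' to X \ {x} -> X \ {y}, when y = g x. *)
Definition translate g (x y : X) (gxy : a g x = y) (z : punctured x) :
  punctured y := mkPunctured (@translate_subproof g x y gxy z).

Definition punctured_fun (x : X) (h : Stab a x) : punctured x -> punctured x :=
  translate (StabP h).

Lemma punctured_fun1 (x : X) z : punctured_fun (1 : Stab a x) z = z.
Proof. by apply: val_inj; rewrite /= gact1. Qed.

Lemma punctured_funM (x : X) (g h : Stab a x) z :
  punctured_fun (g * h) z = punctured_fun g (punctured_fun h z).
Proof. by apply: val_inj; rewrite /= gactM. Qed.

Definition punctured_act (x : X) : gaction (Stab a x) (punctured x) :=
  Gaction (@punctured_fun1 x) (@punctured_funM x).

End punctured.

(** * Properly discontinuous, cocompact and bounded parabolic *)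

Section dynamics.
Context {H : groupType} {V : topologicalType} (a : gaction H V).

Definition meeting (K S : set V) : set H := [set h | a h @` K `&` S !=set0].

Definition properly_discontinuous :=
  forall K : set V, compact K -> finite_set (meeting K K).

Definition covering (K : set V) := \bigcup_(h : H) (a h @` K) = setT.

Definition cocompact := exists2 K : set V, compact K & covering K.

End dynamics.

Definition bounded_parabolic {H : groupType} {X : topologicalType}
    (a : gaction H X) (p : X) :=
  properly_discontinuous (punctured_act a p) /\ cocompact (punctured_act a p).

Section bounded_parabolic_invariance.
Context {H : groupType} {X : topologicalType} (a : gaction H X).
Hypothesis a_cont : forall g, continuous (a g).

Lemma translate_continuous g (x y : X) (gxy : a g x = y) :
  continuous (translate gxy).
Proof.
apply: (@continuous_comp_initial (set_type (~` [set y])) _ _ set_val).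
rewrite (_ : _ \o _ = a g \o set_val)//.
move=> z; apply: continuous_comp; last exact: a_cont.
exact: (@initial_continuous (set_type (~` [set x])) X set_val).
Qed.

Lemma translate_compact g (x y : X) (gxy : a g x = y) (K : set (punctured x)) :
  compact K -> compact (translate gxy @` K).
Proof.
move=> cK; apply: continuous_compact cK.
exact/continuous_subspaceT/translate_continuous.
Qed.

Lemma bounded_parabolic_act g p :
  bounded_parabolic a p -> bounded_parabolic a (a g p).
Proof.
have gp : a g p = a g p by [].
have gp' : a g^-1 (a g p) = p by rewrite gactK.
case=> pd [K cK KP]; split.
  move=> L cL; have := pd _ (translate_compact (gxy := gp') cL).
  move=> /(@finite_preimage _ _ _ (conj_stab gp)) fin.
  apply: (sub_finite_set _ (fin _)).
    move=> h [z [[w Lw <-] Lhw]]; exists (translate gp' (punctured_act a _ h w)).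
    split; last by exists (punctured_act a _ h w).
    exists (translate gp' w); first by exists w.
    by apply: val_inj; rewrite /= -!gactM mulgK.
  move=> h k _ _ /(congr1 val) /= hk; apply: val_inj.
  by apply: (@mulgI _ g^-1); apply: (@mulIg _ g).
exists (translate gp @` K); first exact: translate_compact.
rewrite /covering -subTset => z _.
have [h _ [w Kw hw]] : (\bigcup_h (punctured_act a p h @` K)) (translate gp' z).
  by rewrite KP.
have hP : a (g * val h * g^-1) (a g p) = a g p.
  by rewrite !gactM gactK StabP.
exists (mkStab hP) => //; exists (translate gp w); first by exists w.
apply: val_inj; move/(congr1 val): hw => /= hw.
by rewrite !gactM gactK hw gactKV.
Qed.

End bounded_parabolic_invariance.

(** * Gluings *)

(* [V +_f C] on the disjoint union: [glue_fun f] records [A |-> closure A `&` C]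
   for [A] closed in [V]; its values on other sets are irrelevant. *)
Record gluing (V C : topologicalType) := Gluing {
  glue_fun :> set V -> set C;
  glue_set0 : glue_fun set0 = set0;
  glue_setU : forall A B, closed A -> closed B ->
    glue_fun (A `|` B) = glue_fun A `|` glue_fun B;
  glue_closed : forall A, closed A -> closed (glue_fun A)
}.

Definition glued (V C : topologicalType) (f : gluing V C) : Type := (V + C)%type.

Section gluing_topology.
Context {V C : topologicalType} (f : gluing V C).

HB.instance Definition _ := Choice.on (glued f).

Definition closed_in_glue (B : set (V + C)) :=
  [/\ closed (inl @^-1` B), closed (inr @^-1` B)
    & f (inl @^-1` B) `<=` inr @^-1` B].

Definition open_in_glue (B : set (glued f)) := closed_in_glue (~` B).

Lemma glue_le A B : closed A -> closed B -> A `<=` B -> f A `<=` f B.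
Proof. by move=> cA cB /setUidPr <-; rewrite glue_setU//; left. Qed.

Lemma open_in_glueT : open_in_glue setT.
Proof.
rewrite /open_in_glue setCT; split; rewrite ?preimage_set0; try exact: closed0.
by rewrite glue_set0.
Qed.

Lemma open_in_glueI : setI_closed open_in_glue.
Proof.
move=> A B [Av Ac fA] [Bv Bc fB]; rewrite /open_in_glue setCI.
split; rewrite ?preimage_setU; try exact: closedU.
by rewrite glue_setU//; exact: setUSS.
Qed.

Lemma open_in_glue_bigcup I (B : I -> set (glued f)) :
  (forall i, open_in_glue (B i)) -> open_in_glue (\bigcup_i B i).
Proof.
move=> oB; rewrite /open_in_glue setC_bigcup.
have cV : closed (inl @^-1` (\bigcap_i ~` B i) : set V).
  rewrite preimage_bigcap; apply: closed_bigI => i _; by case: (oB i).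
split => //.
  rewrite preimage_bigcap; apply: closed_bigI => i _; by case: (oB i).
move=> c fc i _; case: (oB i) => cvi _; apply; move: fc; apply: glue_le => //.
by move=> v; apply.
Qed.

HB.instance Definition _ := isOpenTopological.Build (glued f)
  open_in_glueT open_in_glueI open_in_glue_bigcup.

Lemma closed_glueE (B : set (glued f)) : closed B = closed_in_glue B.
Proof. by rewrite -openC /open /= /open_in_glue setCK. Qed.

Lemma glue_funE (A : set V) : closed A ->
  inr @^-1` closure (inl @` A : set (glued f)) = f A.
Proof.
move=> cA; apply/seteqP; split=> c.
  have cB : closed (inl @` A `|` inr @` f A : set (glued f)).
    have El : inl @^-1` (inl @` A `|` inr @` f A : set (V + C)) = A.
      by apply/seteqP; split=> [v [[w Aw [<-]]|[w _]]|v Av]//; left; exists v.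
    have Er : inr @^-1` (inl @` A `|` inr @` f A : set (V + C)) = f A.
      by apply/seteqP; split=> [v [[w _]|[w Aw [<-]]]|v Av]//; right; exists v.
    by rewrite closed_glueE; split; rewrite ?El ?Er//; exact: glue_closed.
  have sAB : inl @` A `<=` (inl @` A `|` inr @` f A : set (glued f)) by left.
  move=> /(@closure_subset (glued f) _ _ sAB).
  by rewrite -(closure_id _).1// => -[[w _]|[w Aw [<-]]].
move=> fc; have := @closed_closure (glued f) (inl @` A).
rewrite closed_glueE => -[cl _ sub]; apply: sub; move: fc; apply: glue_le => //.
by move=> v Av; apply: subset_closure; exists v.
Qed.

Lemma open_inl (A : set V) : open A -> open (inl @` A : set (glued f)).
Proof.
move=> oA; rewrite /open /= /open_in_glue.
have -> : ~` (inl @` A) = inl @` (~` A) `|` range inr :> set (V + C).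
  apply/seteqP; split=> [[v|c] nA|z [[v nAv <-]|[c _ <-]]]; last 2 first.
  - by move=> [w Aw [wv]]; apply: nAv; rewrite -wv.
  - by case.
  - by left; exists v => // Av; apply: nA; exists v.
  - by right; exists c.
have El : inl @^-1` (inl @` (~` A) `|` range inr : set (V + C)) = ~` A.
  by apply/seteqP; split=> [v [[w Aw [<-]]|[w _]]|v Av]//; left; exists v.
have Er : inr @^-1` (inl @` (~` A) `|` range inr : set (V + C)) = setT.
  by apply/seteqP; split=> // c _; right; exists c.
by split; rewrite ?El ?Er//; exact: open_closedC.
Qed.

End gluing_topology.

(* The gluing \partial_\Pi: it reads off the h such that h K meets S. *)
Section Pi.
Context {H : groupType} {V C : topologicalType} (a : gaction H V) (K : set V).
Variable d : gluing (discrete_topology H) C.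

Definition Pi_fun (S : set V) : set C := d (meeting a K S).

Lemma Pi_set0 : Pi_fun set0 = set0.
Proof.
rewrite -[RHS](glue_set0 d); congr (d _).
by apply/seteqP; split=> // h [z []].
Qed.

Lemma Pi_setU A B : closed A -> closed B ->
  Pi_fun (A `|` B) = Pi_fun A `|` Pi_fun B.
Proof.
move=> _ _; rewrite /Pi_fun -glue_setU; try exact: discrete_closed.
congr (d _); apply/seteqP; split=> [h [z [Kz [Az|Bz]]]|].
- by left; exists z.
- by right; exists z.
- by move=> h [[z [Kz Az]]|[z [Kz Az]]]; exists z; split=> //; [left|right].
Qed.

Lemma Pi_closed A : closed A -> closed (Pi_fun A).
Proof. by move=> _; apply: glue_closed; exact: discrete_closed. Qed.

Definition Pi : gluing V C := Gluing Pi_set0 Pi_setU Pi_closed.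

End Pi.

(* Transport of a gluing of discrete groups along a map of the groups. *)
Section transport.
Context {H H' : groupType} {C : topologicalType} (c : H' -> H).
Variable d : gluing (discrete_topology H) C.

Definition transport_fun (S : set (discrete_topology H')) : set C :=
  d (c @` S).

Lemma transport_set0 : transport_fun set0 = set0.
Proof. by rewrite /transport_fun image_set0 glue_set0. Qed.

Lemma transport_setU A B : closed A -> closed B ->
  transport_fun (A `|` B) = transport_fun A `|` transport_fun B.
Proof.
move=> _ _; rewrite /transport_fun -glue_setU ?image_setU//.
all: exact: discrete_closed.
Qed.

Lemma transport_closed A : closed A -> closed (transport_fun A).
Proof. by move=> _; apply: glue_closed; exact: discrete_closed. Qed.

Definition transport : gluing (discrete_topology H') C :=
  Gluing transport_set0 transport_setU transport_closed.

(* For bijective c, transport d is the topology making c and id on C together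
   a homeomorphism onto H +_d C. *)
Lemma transport_homeo (B : set (glued d)) : set_surj setT setT c ->
  open ((fun z : glued transport =>
    match z with inl x => inl (c x) | inr y => inr y end : glued d) @^-1` B)
  <-> open B.
Proof.
move=> csurj; pose m (z : H' + C) : H + C :=
  match z with inl x => inl (c x) | inr y => inr y end.
suff : open_in_glue (f := transport) (m @^-1` B) <-> open_in_glue (f := d) B.
  by [].
have E : c @` (inl @^-1` (~` (m @^-1` B))) = inl @^-1` (~` B).
  apply/seteqP; split=> [_ [x Bx <-]//|x Bx].
  by have [y _ yx] := csurj x I; exists y; rewrite -?yx//= yx.
rewrite /open_in_glue /closed_in_glue /= /transport_fun E.
by split=> -[? ? ?]; split=> //; exact: discrete_closed.
Qed.

End transport.

(** * The class EPers(H) *)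

Section EPers.
Local Open Scope relation_scope.

Record compatible_uniformity (X : topologicalType) (U : set_system (X * X)) :
    Prop := CompatibleUniformity {
  unif_filter : Filter U;
  unif_diagonal : forall u, U u -> diagonal `<=` u;
  unif_inv : forall u, U u -> U u^-1;
  unif_split : forall u, U u -> exists2 v, U v & v \; v `<=` u;
  unif_nbhs : nbhs = nbhs_ U
}.

End EPers.

(* Homeomorphism onto the image. *)
Definition embedding (S T : topologicalType) (f : S -> T) :=
  [/\ injective f, continuous f
    & forall A, open A -> exists2 B, open B & f @` A = B `&` range f].

Definition small_for X (u : set (X * X)) (A : set X) := A `*` A `<=` u.

(* L + eta *)
Definition glued_act (H : groupType) (C : topologicalType)
    (d : gluing (discrete_topology H) C) (eta : gaction H C) :
  gaction H (glued d) := sum_act lmul_act eta.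

(* The compatible uniformity of the compact Hausdorff space [glued d] exists and
   is unique, so the existential below denotes that uniformity. *)
Record EPers (H : groupType) (C : topologicalType)
    (d : gluing (discrete_topology H) C) (eta : gaction H C) : Prop := {
  EPers_compact : compact [set: glued d];
  EPers_hausdorff : hausdorff_space (glued d);
  EPers_continuous : forall h, continuous (glued_act d eta h);
  EPers_perspective : exists2 U : set_system (glued d * glued d),
    compatible_uniformity U &
    forall u (F : set H), U u -> finite_set F ->
      finite_set [set h | ~ small_for u (inl @` ((fun x => h * x) @` F))]
}.

(** * Parabolic blowup *)

(* As Phi = L + phi restricts to phi on Y, the group Stab_phi q is taken to be
   the stabilizer of [inr q] under Phi. *)
Section blowup.
Context {G : groupType} {Y : topologicalType}.
Context {d : gluing (discrete_topology G) Y} {phi : gaction G Y}.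

Local Notation Z := (glued d).
Local Notation Phi := (glued_act d phi).

Definition parabolic : set Y := [set q | bounded_parabolic Phi (inr q)].

Definition orbit_representatives (P' : set Y) :=
  P' `<=` parabolic /\
  forall q, parabolic q -> exists! p, P' p /\ gorbit phi p q.

Hypothesis hZ : EPers d phi.

Lemma parabolic_act_subproof g (q : parabolic) : parabolic (phi g (val q)).
Proof.
by case: q => q /= /set_mem; exact: (bounded_parabolic_act (EPers_continuous hZ)).
Qed.

Definition parabolic_act g (q : parabolic) : parabolic :=
  exist _ (phi g (val q)) (mem_set (@parabolic_act_subproof g q)).

Context {P' : set Y}.
Hypothesis hP' : orbit_representatives P'.

Lemma orbit_repr_subproof (q : parabolic) :
  {p : P' | gorbit phi (val p) (val q)}.
Proof.
have /cid [p [[Pp pq] _]] := hP'.2 _ (set_mem (valP q)).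
by exists (exist _ p (mem_set Pp)).
Qed.

Definition orbit_repr (q : parabolic) : P' := sval (orbit_repr_subproof q).

Lemma orbit_reprP (q : parabolic) : gorbit phi (val (orbit_repr q)) (val q).
Proof. exact: (svalP (orbit_repr_subproof q)). Qed.

Lemma orbit_repr_eq g (q q' : parabolic) :
  phi g (val q) = val q' -> orbit_repr q = orbit_repr q'.
Proof.
move=> gq; apply: val_inj.
have [p [_ up]] := hP'.2 _ (set_mem (valP q')).
rewrite -(up (val (orbit_repr q))) ?(up (val (orbit_repr q')))//.
  by split; [exact: (set_mem (valP (orbit_repr q')))|exact: orbit_reprP].
split; first exact: (set_mem (valP (orbit_repr q))).
by have [k _ kq] := orbit_reprP q; exists (g * k) => //; rewrite gactM kq.
Qed.

Context {C : P' -> topologicalType}.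
Context (dC : forall p : P',
  gluing (discrete_topology (Stab Phi (inr (val p)))) (C p)).
Context (eta : forall p : P', gaction (Stab Phi (inr (val p))) (C p)).
Context {h : P' -> Y -> G}.
Hypothesis hE : forall (p : P') (q : Y),
  gorbit phi (val p) q -> phi (h p q) (val p) = q.
Context (K : forall q : parabolic, set (@punctured Z (inr (val q)))).

Lemma hE_Phi (q : parabolic) :
  Phi (h (orbit_repr q) (val q)) (inr (val (orbit_repr q))) = inr (val q).
Proof. by congr inr; exact: hE (orbit_reprP q). Qed.

(* The gluing \partial_q of Stab q with C_q = C_p, for p the representative. *)
Definition dQ (q : parabolic) :
    gluing (discrete_topology (Stab Phi (inr (val q)))) (C (orbit_repr q)) :=
  transport (conj_stab (hE_Phi q)) (dC (orbit_repr q)).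

(* X_q = (Z \ {q}) +_{(\partial_q)_\Pi} C_q *)
Definition Xq (q : parabolic) : topologicalType :=
  glued (Pi (punctured_act Phi (inr (val q))) (@K q) (dQ q)).

Definition X_proj (q : parabolic) (x : Xq q) : Z :=
  match x with inl z => val z | inr _ => inr (val q) end.

Definition blowup_set : set (Z * prod_topology Xq) :=
  [set zx | forall q, X_proj (zx.2 q) = zx.1].

Definition blowup : topologicalType := set_type blowup_set.

Lemma X_stab_subproof g (q q' : parabolic) : phi g (val q) = val q' ->
  Phi ((h (orbit_repr q) (val q'))^-1 * g * h (orbit_repr q) (val q))
    (inr (val (orbit_repr q)))
  = inr (val (orbit_repr q)).
Proof.
move=> gq; congr inr; rewrite !gactM (hE (orbit_reprP q)) gq.
rewrite -[X in phi _ X](@hE (orbit_repr q)) ?gactK//.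
by rewrite (orbit_repr_eq gq); exact: orbit_reprP.
Qed.

(* The map X_q -> X_q' for q' = g q. The equality C_q = C_q' holds only up to
   the equality of the representatives of q and q', whence the cast. *)
Definition X_act g (q q' : parabolic) (gq : phi g (val q) = val q') (x : Xq q) :
    Xq q' :=
  match x with
  | inl z => inl (translate (congr1 inr gq : Phi g (inr (val q)) = inr (val q')) z)
  | inr c => inr (ecast p (C p) (orbit_repr_eq gq)
      (eta (orbit_repr q) (mkStab (X_stab_subproof gq)) c))
  end.

Lemma X_proj_act g (q q' : parabolic) (gq : phi g (val q) = val q') (x : Xq q) :
  X_proj (X_act gq x) = Phi g (X_proj x).
Proof. by case: x => //= c; rewrite gq. Qed.

Lemma parabolic_actK g (q : parabolic) :
  phi g (val (parabolic_act g^-1 q)) = val q.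
Proof. exact: gactKV. Qed.

Definition blowup_fun_coord g (x : prod_topology Xq) : prod_topology Xq :=
  fun q => X_act (parabolic_actK g q) (x (parabolic_act g^-1 q)).

Lemma blowup_fun_subproof g (x : blowup) :
  blowup_set (Phi g (val x).1, blowup_fun_coord g (val x).2).
Proof.
by move=> q /=; rewrite X_proj_act (set_mem (valP x)).
Qed.

Definition blowup_fun g (x : blowup) : blowup :=
  exist _ (Phi g (val x).1, blowup_fun_coord g (val x).2)
    (mem_set (@blowup_fun_subproof g x)).

Lemma X_act1 (q q' : parabolic) (q1 : phi 1 (val q) = val q')
    (x : prod_topology Xq) : X_act q1 (x q) = x q'.
Proof.
have qq' : q = q' by apply: val_inj; rewrite -q1 gact1.
case: q' / qq' q1 => q1; case: (x q) => [z|c] /=.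
  by congr inl; apply: val_inj; exact: (gact1 Phi).
rewrite (_ : mkStab _ = 1) ?gact1; last first.
  by apply: val_inj; rewrite /= mulg1 mulVg.
by rewrite (eq_irrelevance (orbit_repr_eq q1) erefl).
Qed.

Lemma ecast_etaM (p p' p'' : P') (e : p = p') (e' : p' = p'') (e'' : p = p'')
    (s : Stab Phi (inr (val p))) (s' : Stab Phi (inr (val p')))
    (s'' : Stab Phi (inr (val p))) (c : C p) : val s'' = val s' * val s ->
  ecast p (C p) e'' (eta _ s'' c) =
  ecast p (C p) e' (eta _ s' (ecast p (C p) e (eta _ s c))).
Proof.
case: p' / e e' s' => e'; case: p'' / e' e'' => e'' s' sE.
rewrite (eq_irrelevance e'' erefl) /= -gactM; congr (eta _ _ _).
exact: val_inj.
Qed.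

Lemma X_actM g k (q q' q'' : parabolic) (e : phi k (val q) = val q')
    (e' : phi g (val q') = val q'') (e'' : phi (g * k) (val q) = val q'')
    (x : Xq q) : X_act e'' x = X_act e' (X_act e x).
Proof.
case: x => [z|c] /=.
  by congr inl; apply: val_inj; exact: (gactM Phi).
congr inr; apply: ecast_etaM => /=.
by rewrite (orbit_repr_eq e) !mulgA mulgK.
Qed.

Lemma X_act_eq g (q1 q2 q : parabolic) (e1 : phi g (val q1) = val q)
    (e2 : phi g (val q2) = val q) (x : prod_topology Xq) : q1 = q2 ->
  X_act e1 (x q1) = X_act e2 (x q2).
Proof.
move=> qq; case: q2 / qq e2 => e2; congr (X_act _ _); exact: Prop_irrelevance.
Qed.

Lemma blowup_fun1 x : blowup_fun 1 x = x.
Proof.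
apply: val_inj; case: x => -[z x] xP /=; congr pair; first exact: (gact1 Phi).
by apply: functional_extensionality_dep => q; exact: X_act1.
Qed.

Lemma blowup_funM g k x : blowup_fun (g * k) x = blowup_fun g (blowup_fun k x).
Proof.
apply: val_inj; case: x => -[z x] xP /=; congr pair; first exact: (gactM Phi).
apply: functional_extensionality_dep => q; rewrite /blowup_fun_coord.
set q1 := parabolic_act g^-1 q; set q2 := parabolic_act k^-1 q1.
have q2E : phi (g * k) (val q2) = val q by rewrite gactM !parabolic_actK.
have qq : parabolic_act (g * k)^-1 q = q2.
  by apply: val_inj; rewrite /= invgM gactM.
rewrite (X_act_eq _ q2E _ qq); exact: X_actM.
Qed.

(* Phi \ltimes eta *)
Definition blowup_act : gaction G blowup := Gaction blowup_fun1 blowup_funM.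

Lemma inl_in_punctured (g : G) (y : Y) : (inl g : Z) <> inr y.
Proof. by []. Qed.

Definition X_incl (q : parabolic) (g : G) : Xq q :=
  inl (mkPunctured (@inl_in_punctured g (val q))).

Lemma blowup_incl_subproof (g : G) : blowup_set (inl g, X_incl ^~ g).
Proof. by []. Qed.

Definition blowup_incl (g : discrete_topology G) : blowup :=
  exist _ (inl g, X_incl ^~ g) (mem_set (@blowup_incl_subproof g)).

End blowup.

Arguments parabolic {G Y} d phi.
Arguments orbit_representatives {G Y} d phi P'.

(* Main.v *)
(* A point of the blowup lying over an element of G is determined by its first
   coordinate, since each projection X_q -> Z is injective off C_q. Hence the
   image under iota of a subset A of G is the preimage of A under the projection
   to Z, which is open because G is open and discrete in Z. *)
Require Import Defs.
From mathcomp Require Import all_boot all_classical.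
From mathcomp Require Import topology_structure compact discrete_topology.
From mathcomp Require Import initial_topology product_topology subtype_topology.

Local Open Scope classical_set_scope.
Local Open Scope group_scope.

Lemma blowup_incl_image (G : groupType) (Y : topologicalType)
  (d : gluing (discrete_topology G) Y) (phi : gaction G Y)
  (P' : set Y) (hP' : orbit_representatives d phi P')
  (C : P' -> topologicalType)
  (dC : forall p : P',
    gluing (discrete_topology (Stab (glued_act d phi) (inr (val p)))) (C p))
  (h : P' -> Y -> G)
  (hE : forall (p : P') (q : Y), gorbit phi (val p) q -> phi (h p q) (val p) = q)
  (K : forall q : parabolic d phi, set (@punctured (glued d) (inr (val q))))
  (A : set (discrete_topology G)) :
  blowup_incl hP' dC hE K @` A =
  (fun x : blowup hP' dC hE K => (val x).1) @^-1` (inl @` A).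
Proof.
apply/seteqP; split=> [_ [g Ag <-]|x [g Ag gx]]; first by exists g.
exists g => //; apply: val_inj.
case: x gx => -[z x] /= xP zE; case: z / zE xP => xP; congr pair.
apply: functional_extensionality_dep => q.
(* A point of [C_q] would project to [inr (val q)], never to [inl g]; so [x q] lies in the punctured
   part, where the projection is injective. *)
have := set_mem xP q; rewrite /=; case: (x q) => //= z zE.
by congr inl; apply: val_inj; rewrite /= zE.
Qed.

(** Taking [A] arbitrary yields the embedding property; [A = setT] yields the open image. *)
Lemma blowup_incl_open (G : groupType) (Y : topologicalType)
  (d : gluing (discrete_topology G) Y) (phi : gaction G Y)
  (P' : set Y) (hP' : orbit_representatives d phi P')
  (C : P' -> topologicalType)
  (dC : forall p : P',
    gluing (discrete_topology (Stab (glued_act d phi) (inr (val p)))) (C p))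
  (h : P' -> Y -> G)
  (hE : forall (p : P') (q : Y), gorbit phi (val p) q -> phi (h p q) (val p) = q)
  (K : forall q : parabolic d phi, set (@punctured (glued d) (inr (val q))))
  (A : set (discrete_topology G)) :
  open (blowup_incl hP' dC hE K @` A).
Proof.
rewrite blowup_incl_image; apply: open_comp; last first.
  by apply: open_inl; exact: discrete_open.
move=> x _; apply: (@continuous_comp _ _ _ set_val fst).
  exact: initial_continuous.
exact: cvg_fst.
Qed.

Theorem proposition2p14 (G : groupType) (Y : topologicalType)
  (d : gluing (discrete_topology G) Y) (phi : gaction G Y)
  (hZ : EPers d phi)
  (P' : set Y) (hP' : orbit_representatives d phi P')
  (C : P' -> topologicalType)
  (dC : forall p : P',
    gluing (discrete_topology (Stab (glued_act d phi) (inr (val p)))) (C p))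
  (eta : forall p : P', gaction (Stab (glued_act d phi) (inr (val p))) (C p))
  (hC : forall p : P', EPers (dC p) (eta p))
  (h : P' -> Y -> G)
  (hE : forall (p : P') (q : Y), gorbit phi (val p) q -> phi (h p q) (val p) = q)
  (h1 : forall p : P', h p (val p) = 1)
  (K : forall q : parabolic d phi, set (@punctured (glued d) (inr (val q))))
  (K_compact : forall q, compact (K q))
  (K_covering : forall q,
    covering (punctured_act (glued_act d phi) (inr (val q))) (K q)) :
  let iota := blowup_incl hP' dC hE K in
  let Phi_eta := blowup_act hZ hP' dC eta hE K in
  [/\ embedding iota,
      open (range iota) &
      forall g x : G, iota (lmul_act g x) = Phi_eta g (iota x)].
Proof.
move=> iota Phi_eta; split.
- split=> [g k /(congr1 val) [] //||A _].
    by apply/continuousP => A _; exact: discrete_open.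
  (* The image is itself open in the blowup, so it serves as its own open witness. *)
  exists (iota @` A); first exact: blowup_incl_open.
  by apply/esym/setIidPl; exact: image_subset.
- exact: blowup_incl_open.
(* The first coordinates agree by computation. Over each [q] only the [inl] branch of [X_act]
   occurs, so [eta] and the cast do not enter, and the two points differ at most in their proofs of
   avoiding [q]. *)
- move=> g x; apply: val_inj => /=; congr pair.
  apply: functional_extensionality_dep => q.
  by congr inl; exact: val_inj.
Qed.
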